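(* Let $\alpha$ be a (trivalent) combinatorial type of a rational (i.e. genus $0$) cover $h:\Gamma\to\mathcal L$. Let $\Gamma'$ be the graph obtained from $\Gamma$ by identifying all vertices mapping to $c$ to one vertex. Then the weight $\omega(\alpha)$ of the cone $D_\alpha$ coincides with the weight $$\prod_{V}H_V\cdot\gcd_{T}\Big(\prod_{e\in T^c}w(e)\Big)$$ assigned to it by Gathmann–Markwig–Ochse, where the product is over all vertices $V$ mapped to $c$, the $\gcd$ is taken over all spanning trees $T$ of $\Gamma'$, $T^c$ is the set of edges of $\Gamma'$ not in $T$, and $w(e)$ is the weight of $e$.
   Context: **Tropical curves.** A tropical curve $\Gamma$ is a connected finite metric graph. One-valent vertices are called leaves, all other vertices inner vertices. An edge adjacent to a leaf is an end and has length $\infty$; the other edges are bounded and have a length $l(e)\in\mathbb R_{>0}$. Each end is marked by a number. Each inner vertex $V$ carries a genus $g_V\in\mathbb N$ ($0$ allowed), with $g_V\ge1$ if $\mathrm{val}(V)=2$, and finitely many labels such that the disjoint union of all labels is $\{1,\dots,r\}$ for some $r$. The genus of $\Gamma$ is $b^1(\Gamma)+\sum_Vg_V$. The combinatorial type of $\Gamma$ is obtained by forgetting the lengths. **Covers.** $\mathcal L$ is the tropical curve with one inner vertex $c$ (genus $0$) and three ends $u,v,w$ adjacent to $c$. A cover of $\mathcal L$ is a tropical curve $\Gamma$ with a continuous map $h:\Gamma\to\mathcal L$ such that: (i) every (open) edge of $\Gamma$ maps into an edge of $\mathcal L$, and $h$ is affine linear there with nonzero integer slope, whose absolute value $w_e=w(e)$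 is the weight of $e$; (ii) (balancing) for each vertex $V$, the sum of the weights of the edges at $V$ mapped to a given direction at $h(V)$ is the same for every direction at $h(V)$ (three directions if $h(V)=c$, two otherwise); this sum is the local degree $\deg_hV$; (iii) for each inner vertex $V$ the RH-number $r_V:=(\mathrm{val}(V)+2g_V-2)-\deg_hV\cdot(\mathrm{val}(h(V))-2)$ is $\ge0$, where $\mathrm{val}(c)=3$ and $\mathrm{val}(h(V))=2$ if $h(V)\ne c$; (iv) each inner vertex $V$ has exactly $r_V$ labels. An automorphism of $h$ is an automorphism $\phi$ of $\Gamma$ (as a metric graph, preserving vertex genera, vertex labels and end markings) with $h\circ\phi=h$; $\mathrm{Aut}(h)$ is the automorphism group. The combinatorial type $\alpha$ of $h$ is the combinatorial type of $\Gamma$ with all edge weights and the set of vertices mapped to $c$. A type is trivalent if all vertices over $c$ have RH-number $0$ and all other inner vertices are trivalent of genus $0$. **Cone and index.** Let $B$ be the number of bounded edges. For each cycle in a basis of $H_1(\Gamma',\mathbb Z)$, written as a chain of directed edges, there is the equation $\sum_e\pm w_e\,l(e)=0$ (sign $+$ if $e$ is traversed away from $c$, $-$ otherwise, with multiplicity; common factors not cancelled) expressing that the image of the cycle closes up. These define an integer matrix $A_\alpha:\mathbb Z^B\to\mathbb Z^{b^1(\Gamma')}$; the open cone $D_\alpha=\{x\in\mathbb R_{>0}^B:A_\alpha x=0\}$ parametrizes covers of type $\alpha$, and $I_\alpha$ is the index of $A_\alpha(\mathbb Z^B)$ in $\mathbb Z^{b^1(\Gamma')}$. **Weight.** The (triple)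 Hurwitz number $H^g_d(\Delta)$, for a triple $\Delta=(\Delta_u,\Delta_v,\Delta_w)$ of partitions of $d$ with $\#\Delta$ parts in total, is the number, weighted by $1/|\mathrm{Aut}(f)|$, of degree $d$ covers $f:C\to\mathbb P^1$ by smooth connected genus $g$ curves with all preimages of $0,1,\infty$ marked, ramification profiles $\Delta_u,\Delta_v,\Delta_w$ over $0,1,\infty$ (the $i$-th marked point having the ramification index given by the $i$-th part), simple ramification over $\#\Delta+2g-2-d$ further fixed points and no other ramification. For a vertex $V$ over $c$, $H_V:=H^{g_V}_{d'}(\Delta'_u,\Delta'_v,\Delta'_w)$, where $d'=\deg_hV$ and $\Delta'_u,\Delta'_v,\Delta'_w$ are the partitions given by the weights of the edges at $V$ mapping to $u,v,w$. For a trivalent type $\alpha$, $\omega(\alpha):=\frac1{2^k}\cdot I_\alpha\cdot\prod_{V:h(V)=c}H_V$ with $2^k=|\mathrm{Aut}(h)|$, $h$ a cover of type $\alpha$. *)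

(* Defs.v *)
From HB Require Import structures.
From mathcomp Require Import all_boot all_order all_algebra all_fingroup all_field.
From mathcomp Require Import finmap complex.
From mathcomp Require Import all_classical all_reals.

Set Implicit Arguments.
Unset Strict Implicit.
Unset Printing Implicit Defensive.

Import Order.TTheory GRing.Theory Num.Theory.

Local Open Scope classical_set_scope.
Local Open Scope ring_scope.

(* A [dart] is an edge with a direction; [flip] reverses the direction, so that
   the edges are the orbits {d, flip d}.  Loops and multiple edges are allowed. *)
Record graph := Graph {
  vert : finType;
  dart : finType;
  src : dart -> vert;
  flip : dart -> dart;
  flipK : involutive flip;
  flip_neq : forall d, flip d != d }.

Definition tgt (G : graph) (d : dart G) : vert G := src (flip d).

Definition darts_at (G : graph) (v : vert G) : {set dart G} :=
  [set d | src d == v]%SET.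

Definition valence (G : graph) (v : vert G) : nat := #|darts_at v|.

(* A set of edges is given by the set of its darts. *)
Definition edge_set (G : graph) (T : {set dart G}) : bool :=
  [forall d in T, flip d \in T].

Definition adjacent_in (G : graph) (T : {set dart G}) : rel (vert G) :=
  fun x y => [exists d in T, (src d == x) && (tgt d == y)].

Definition connected_by (G : graph) (T : {set dart G}) : bool :=
  (0 < #|vert G|)%N && [forall x, forall y, connect (adjacent_in T) x y].

(* The chain z traverses the edge of d, in the direction of d, z d times more
   often than in the opposite direction. *)
Definition chain (G : graph) := {ffun dart G -> int}.

Definition is_cycle (G : graph) (z : chain G) : Prop :=
  (forall d, z (flip d) = - z d) /\
  (forall v, \sum_(d in darts_at v) z d = 0).

Definition H1_basis (G : graph) (n : nat) (z : {ffun 'I_n -> chain G}) : Prop :=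
  (forall i, is_cycle (z i)) /\
  (forall c, is_cycle c ->
     exists! a : {ffun 'I_n -> int}, c = \sum_i z i *~ a i).

(* Rank of H_1(G, Z), which is free of finite rank: the default value of [xget]
   is not used, here and below. *)
Definition b1 (G : graph) : nat :=
  xget 0%N [set n | exists z : {ffun 'I_n -> chain G}, H1_basis z].

Definition some_H1_basis (G : graph) : {ffun 'I_(b1 G) -> chain G} :=
  xget [ffun=> [ffun=> 0]] [set z | H1_basis z].

Definition spanning_tree (G : graph) (T : {set dart G}) : Prop :=
  [/\ edge_set T, connected_by T
    & forall z : chain G,
        is_cycle z -> (forall d, d \notin T -> z d = 0) -> z = [ffun=> 0]].

Definition leaf (G : graph) (v : vert G) : bool := valence v == 1%N.

Definition is_end (G : graph) (d : dart G) : bool := leaf (src d) || leaf (tgt d).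

(* The combinatorial type of a tropical curve.  [gen] is relevant on inner
   vertices only, [mark] on ends only. *)
Record ctcurve := CTCurve {
  cgraph :> graph;
  gen : vert cgraph -> nat;
  nlab : nat;
  lab : 'I_nlab -> vert cgraph;
  mark : dart cgraph -> nat;
  ctcurve_connected : connected_by [set: dart cgraph]%SET;
  gen_bivalent : forall v, valence v = 2%N -> (1 <= gen v)%N;
  lab_inner : forall k, ~~ leaf (lab k);
  mark_rev : forall d, mark (flip d) = mark d;
  mark_inj : forall d d', is_end d -> is_end d' -> mark d = mark d' ->
    d' = d \/ d' = flip d }.

Definition genus (G : ctcurve) : nat :=
  (b1 G + \sum_(v : vert G | ~~ leaf v) gen v)%N.

Record tcurve (R : realType) := TCurve {
  ctype :> ctcurve;
  len : dart ctype -> \bar R;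
  len_rev : forall d, len (flip d) = len d;
  len_end : forall d, is_end d -> len d = +oo%E;
  len_bounded : forall d, ~~ is_end d -> (0 < len d < +oo)%E }.

(* The three ends u, v, w of L are numbered 0, 1, 2. *)
Definition ray := 'I_3.

(* [slope d] is the slope, in the direction of d, of the distance from c; its
   absolute value is the weight.  [onray d] is the edge of L the edge of d is
   mapped to.  [over_c] is the set of vertices mapped to c. *)
Record cover_type := CoverType {
  tgraph :> ctcurve;
  slope : dart tgraph -> int;
  onray : dart tgraph -> ray;
  over_c : {set vert tgraph} }.

Section TypeData.
Variable a : cover_type.
Implicit Types (d : dart a) (v : vert a).

Definition wt d : nat := `|slope d|%N.

(* The darts pointing away from c: exactly one for each edge of a cover. *)
Definition outward d : bool := 0 < slope d.

Definition ray_weight v (i : ray) : nat :=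
  (\sum_(d in darts_at v | onray d == i) wt d)%N.
Definition out_weight v : nat := (\sum_(d in darts_at v | outward d) wt d)%N.
Definition in_weight v : nat := (\sum_(d in darts_at v | ~~ outward d) wt d)%N.

Definition balanced v : Prop :=
  if v \in over_c a then forall i j, ray_weight v i = ray_weight v j
  else out_weight v = in_weight v.

Definition ldeg v : nat :=
  if v \in over_c a then ray_weight v ord0 else out_weight v.

Definition RH v : int :=
  ((valence v)%:Z + 2 * (gen v)%:Z - 2)
  - (ldeg v)%:Z * ((if v \in over_c a then 3 else 2) - 2).

Definition trivalent : Prop :=
  forall v, ~~ leaf v ->
    if v \in over_c a then RH v = 0 else valence v = 3%N /\ gen v = 0%N.

(* The graph Gamma', whose vertices are the classes of the identification. *)
Definition glue_class v : {set vert a} := if v \in over_c a then over_c a else [set v]%SET.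

Definition glued_vert := {B : {set vert a} | B \in [set glue_class v | v : vert a]%SET}.

Definition glue v : glued_vert :=
  exist _ (glue_class v) (imset_f glue_class (isT : v \in vert a)).

Definition glued : graph :=
  @Graph glued_vert (dart a) (fun d => glue (src d)) (@flip a) (@flipK a) (@flip_neq a).

(* One dart for every bounded edge of Gamma. *)
Definition bounded_edges : {set dart a} := [set d | ~~ is_end d & outward d]%SET.

Definition A_mx : 'M[int]_(b1 glued, #|bounded_edges|) :=
  \matrix_(j, e) ((wt (enum_val e))%:Z * some_H1_basis glued j (enum_val e)).

End TypeData.

Definition image_cosets (m n : nat) (A : 'M[int]_(m, n)) : set (set 'cV[int]_m) :=
  [set [set y + A *m x | x in [set: 'cV[int]_n]] | y in [set: 'cV[int]_m]].

(* [fset_set] of an infinite set is empty: an infinite index is encoded as 0. *)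
Definition image_index (m n : nat) (A : 'M[int]_(m, n)) : nat :=
  #|` fset_set (image_cosets A)|%fset.

Definition I_index (a : cover_type) : nat := image_index (A_mx a).

Definition gcd_trees (a : cover_type) : nat :=
  \big[gcdn/0%N]_(T : {set dart (glued a)} | `[< spanning_tree T >])
     (\prod_(d : dart a | (d \notin T) && outward d) wt d)%N.

(* [None] is c; [Some (i, x)] is the point of the end i at distance x from c,
   which is the leaf of L if x = +oo. *)
Definition Lpoint (R : realType) := option (ray * \bar R).

Definition on_ray (R : realType) (i : ray) (x : \bar R) : Lpoint R :=
  if x == 0%E then None else Some (i, x).

(* The map is given by the images [vimage] of the vertices and by its affine linear
   restrictions to the edges. *)
Record lcover (R : realType) := LCover {
  domain :> tcurve R;
  vimage : vert domain -> Lpoint R;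
  cslope : dart domain -> int;
  cray : dart domain -> ray;
  cover_type_of : cover_type :=
    @CoverType domain cslope cray [set v | vimage v == None]%SET;
  pos_gt0 : forall v i x, vimage v = Some (i, x) -> (0 < x)%E;
  pos_leaf : forall v, leaf v = [exists i, vimage v == Some (i, +oo%E)];
  cslope_neq0 : forall d, cslope d != 0;
  cslope_rev : forall d, cslope (flip d) = - cslope d;
  cray_rev : forall d, cray (flip d) = cray d;
  affine : forall d, 0 < cslope d -> exists x : R,
    [/\ 0 <= x, vimage (src d) = on_ray (cray d) x%:E
      & vimage (tgt d) = on_ray (cray d) (x%:E + ((cslope d)%:~R)%:E * len d)%E];
  cover_balanced : forall v : vert cover_type_of, ~~ leaf v -> balanced v;
  RH_ge0 : forall v : vert cover_type_of, ~~ leaf v -> 0 <= RH v;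
  RH_lab : forall v : vert cover_type_of, ~~ leaf v ->
    #|[set k | lab k == v]%SET|%:Z = RH v }.

Definition cover_Aut (R : realType) (h : lcover R) : {set {perm vert h} * {perm dart h}} :=
  [set f : {perm vert h} * {perm dart h} |
           [&& [forall d, src (f.2 d) == f.1 (src d)],
               [forall d, flip (f.2 d) == f.2 (flip d)],
               [forall d, len (f.2 d) == len d],
               [forall v, ~~ leaf v ==> (gen (f.1 v) == gen v)],
               [forall k, f.1 (lab k) == lab k],
               [forall d, is_end d ==> (mark (f.2 d) == mark d)],
               [forall v, vimage (f.1 v) == vimage v],
               [forall d, cslope (f.2 d) == cslope d] &
               [forall d, cray (f.2 d) == cray d]]]%SET.

(* A smooth connected projective curve with a degree d map to P^1 is given by
   its function field, a degree d extension L of C(x); its points are the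
   discrete valuations of L which are trivial on C. *)
Section FunctionFields.
Variable R : realType.
Local Notation CC := (R[i]).
Local Notation Cx := {fraction {poly CC}}.
Variable L : fieldExtType Cx.

Definition const (c : CC) : Cx := tofrac c%:P.

(* Normalized valuations; the value at 0 is irrelevant and set to 0. *)
Definition is_point (p : L -> int) : Prop :=
  [/\ p 0 = 0,
      forall f g, f != 0 -> g != 0 -> p (f * g) = p f + p g,
      forall f g, f != 0 -> g != 0 -> f + g != 0 ->
        Num.min (p f) (p g) <= p (f + g),
      forall c, c != 0 -> p (const c)%:A = 0
    & exists2 t, t != 0 & p t = 1].

(* The point b of P^1, with [None] for infinity. *)
Definition local_param (b : option CC) : Cx :=
  if b is Some c then tofrac ('X - c%:P) else (tofrac 'X)^-1.

(* The ramification index of the point p if p lies over b; nonpositive if it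
   does not. *)
Definition ram (p : L -> int) (b : option CC) : int := p (local_param b)%:A.

Definition lies_over (p : L -> int) (b : option CC) : Prop :=
  is_point p /\ 0 < ram p b.

(* The divisor \sum_j m_j p_j. *)
Record divisor := Divisor {
  dsize : nat;
  dpoint : 'I_dsize -> L -> int;
  dmult : 'I_dsize -> int;
  dpointP : forall j, is_point (dpoint j) }.

Definition ddeg (D : divisor) : int := \sum_j @dmult D j.
Definition dcoef (D : divisor) (p : L -> int) : int :=
  \sum_(j | `[< @dpoint D j = p >]) @dmult D j.

Definition riemann_roch_space (D : divisor) : set L :=
  [set f | f = 0 \/ forall p, is_point p -> - dcoef D p <= p f].

Definition CC_dim (W : set L) (n : nat) : Prop :=
  exists2 b : 'I_n -> L, forall i, W (b i) &
    forall f, W f -> exists! c : {ffun 'I_n -> CC}, f = \sum_i const (c i) *: b i.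

(* The genus is the maximum of deg D - dim L(D) + 1 over all divisors D. *)
Definition has_genus (g : nat) : Prop :=
  (forall D n, CC_dim (riemann_roch_space D) n -> ddeg D + 1 <= n%:Z + g%:Z) /\
  (exists D n, CC_dim (riemann_roch_space D) n /\ ddeg D + 1 = n%:Z + g%:Z).

End FunctionFields.

Section Hurwitz.
Variable R : realType.
Local Notation CC := (R[i]).
Local Notation Cx := {fraction {poly CC}}.
Variables (g d : nat) (Delta : ray -> seq nat).

Definition special (i : ray) : option CC :=
  nth None [:: Some 0; Some 1; None] i.

Definition num_simple : nat := (\sum_i size (Delta i) + 2 * g - (d + 2))%N.

(* The number does not depend on the choice of the further branch points. *)
Definition simple_branch (k : nat) : option CC := Some (k.+2)%:R.

Record hcover := HCover {
  hfield : fieldExtType Cx;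
  hmark : forall i : ray, 'I_(size (Delta i)) -> hfield -> int;
  hcover_deg : \dim {:hfield} = d;
  hcover_genus : has_genus hfield g;
  hmark_over : forall i j, lies_over (hmark (i:=i) j) (special i);
  hmark_inj : forall i, injective (@hmark i);
  hmark_all : forall i p, lies_over p (special i) -> exists j, p = @hmark i j;
  hmark_ram : forall i j, ram (@hmark i j) (special i) = (nth 0%N (Delta i) j)%:Z;
  hcover_simple : forall k, (k < num_simple)%N ->
    exists p : hfield -> int,
      [/\ lies_over p (simple_branch k), ram p (simple_branch k) = 2
        & forall q, lies_over q (simple_branch k) -> q <> p ->
            ram q (simple_branch k) = 1];
  hcover_unram : forall b (p : hfield -> int), lies_over p b ->
    (forall i, b <> special i) ->
    (forall k, (k < num_simple)%N -> b <> simple_branch k) ->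
    ram p b = 1 }.

(* Isomorphisms over P^1 preserving the markings; phi is the pullback of
   functions, the image of the point p is p \o phi. *)
Definition hiso (X Y : hcover) (phi : 'AHom(hfield Y, hfield X)) : Prop :=
  bijective phi /\ forall i j, @hmark X i j \o phi = @hmark Y i j.

Definition haut (X : hcover) : nat :=
  #|` fset_set [set phi : 'AEnd(hfield X) | hiso phi] |%fset.

(* The X_k form a system of representatives of the isomorphism classes. *)
Definition hurwitz : rat :=
  xget 0 [set q : rat | exists (n : nat) (X : 'I_n -> hcover),
    [/\ forall Y, exists k, exists phi, hiso (X := X k) (Y := Y) phi,
        forall k l phi, hiso (X := X k) (Y := X l) phi -> k = l
      & q = \sum_k ((haut (X k))%:R)^-1]].

End Hurwitz.

Section Weights.
Variables (R : realType) (a : cover_type).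

Definition profile (v : vert a) (i : ray) : seq nat :=
  [seq wt d | d <- enum (darts_at v) & onray d == i].

Definition H_vert (v : vert a) : rat :=
  hurwitz R (gen v) (ldeg v) (profile v).

End Weights.

(* |Aut(h)| is the number written 2^k for a trivalent type; h is the cover used
   to compute it. *)
Definition omega (R : realType) (h : lcover R) : rat :=
  let a := cover_type_of h in
  (#|cover_Aut h|%:R)^-1 * (I_index a)%:R * \prod_(v in over_c a) H_vert R v.

Definition gmo_weight (R : realType) (a : cover_type) : rat :=
  (\prod_(v in over_c a) H_vert R v) * (gcd_trees a)%:R.

(* Main.v *)
(* A rational curve is a tree whose ends are marked, so an automorphism of the cover fixes every
   end.  If it moved some edge, the moved edges would form a forest; an edge at a one-valent
   vertex of this forest is the only moved edge at that vertex, hence is fixed after all.  So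
   Aut(h) is trivial.

   By the Smith normal form, the index of the image of an integer matrix is the gcd of its maximal
   minors (0 if the rank is not maximal).  A maximal minor of A_alpha is the product of the
   weights of the chosen edges times a minor of the matrix of a basis of H_1.  The latter is +-1
   if the unchosen edges form a spanning tree T, because the fundamental cycles of T are then a
   dual basis, and 0 otherwise: a cut of the unchosen edges is a linear relation between the
   columns, and a cycle among the unchosen edges one between the rows.
   Ends lie in every spanning tree, so nothing is lost by choosing among the bounded edges only. *)
Require Import Defs.
From mathcomp Require Import all_boot all_order all_algebra all_reals.
From mathcomp Require Import finmap all_classical all_fingroup.
From mathcomp Require Import finset.

Set Implicit Arguments.
Unset Strict Implicit.
Unset Printing Implicit Defensive.

Import Order.TTheory GRing.Theory Num.Theory.

Local Open Scope ring_scope.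

(** * The index of an integer matrix and its maximal minors *)

(** Cauchy-Binet before terms are collected: each row of [A *m B] is a combination of rows of [B],
    and the determinant is multilinear in the rows. A non-injective [f] repeats a row and
    contributes 0. *)
Lemma det_mulmx_rowsub (R : comNzRingType) (m n : nat) (A : 'M[R]_(m, n)) (B : 'M[R]_(n, m)) :
  \det (A *m B) =
  \sum_(f : {ffun 'I_m -> 'I_n}) (\prod_i A i (f i)) * \det (rowsub f B).
Proof.
pose AB (s : 'S_m) i j := A i j * B j (s i).
transitivity (\sum_(f : {ffun 'I_m -> 'I_n}) \sum_(s : 'S_m)
    (-1) ^+ s * \prod_i AB s i (f i)).
  rewrite exchange_big; apply: eq_bigr => /= s _; rewrite -big_distrr /=.
  congr (_ * _); rewrite -(bigA_distr_bigA (AB s)) /=.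
  by apply: eq_bigr => x _; rewrite mxE.
apply: eq_bigr => f _; rewrite big_distrr /=; apply: eq_bigr => s _.
rewrite mulrCA big_split /=; congr (_ * (_ * _)).
by apply: eq_bigr => i _; rewrite mxE.
Qed.

(** Transposing turns column selections of [A] into row selections, so the expansion writes the
    determinant as an integer combination of maximal minors of [A]. *)
Lemma dvdz_det_mulmx (m n : nat) (A : 'M[int]_(m, n)) (B : 'M[int]_(n, m)) (g : int) :
  (forall f : {ffun 'I_m -> 'I_n}, (g %| \det (colsub f A))%Z) ->
  (g %| \det (A *m B))%Z.
Proof.
move=> hg; rewrite -det_tr trmx_mul det_mulmx_rowsub.
apply: rpred_sum => f _; apply: dvdz_mull.
by have := hg f; rewrite -det_tr trmx_mxsub.
Qed.

(** In Smith coordinates the image is that of a diagonal matrix, so membership is one divisibility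
    per row. A row beyond the [n] columns is zero; its divisor is 0, which divides only 0. *)
Lemma image_divisibility (m n : nat) (A : 'M[int]_(m, n)) :
  exists (L : 'M[int]_m) (delta : 'I_m -> int), L \in unitmx /\
    forall u : 'cV_m, (exists x, u = A *m x) <->
      forall i, (delta i %| (L *m u) i 0%R)%Z.
Proof.
have [L uL [Q uQ [d _ ->]]] := int_Smith_normal_form A.
exists (invmx L), (fun i => if (i < n)%N then d`_i else 0).
rewrite unitmx_inv; split=> // u.
set D := \matrix_(_, _) _.
have DE (y : 'cV[int]_n) (i : 'I_m) :
    (D *m y) i 0 = if insub (i : nat) is Some j then d`_i * y j 0 else 0.
  rewrite mxE; case: insubP => [j _ ji|].
    rewrite (bigD1 j) //= big1 ?addr0 => [|k kj]; first by rewrite mxE ji eqxx.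
    rewrite mxE; have [ik|_] := eqVneq (i : nat) k; last by rewrite mulr0n mul0r.
    by case/eqP: kj; apply: val_inj; rewrite /= ji ik.
  rewrite -leqNgt => ni; rewrite big1 // => k _.
  by rewrite mxE gtn_eqF ?mulr0n ?mul0r // (leq_trans (ltn_ord k)).
split=> [[x ->] i|hu].
  rewrite -!mulmxA mulKmx // DE; case: insubP => [j -> _|/negPf ->].
    exact: dvdz_mulr.
  by rewrite dvdz0.
pose y : 'cV[int]_n := \col_j
  (if (insub (j : nat) : option 'I_m) is Some i then ((invmx L *m u) i 0%R %/ d`_j)%Z else 0).
exists (invmx Q *m y); rewrite -!mulmxA (mulmxA Q) mulmxV // mul1mx.
apply: (canRL (mulKVmx uL)); apply/colP => i; rewrite DE.
have := hu i; case: insubP => [j -> ji|/negPf ->]; last by rewrite dvd0z => /eqP.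
rewrite [X in _ * X]mxE; case: (insubP 'I_m (j : nat)) => [i' _ ii'|]; last by rewrite ji ltn_ord.
have -> : i' = i by apply: val_inj; rewrite /= ii' ji.
by rewrite ji [RHS]mulrC => /divzK.
Qed.

Section Cosets.
Local Open Scope classical_set_scope.
Variables (m n : nat) (A : 'M[int]_(m, n)).

Definition image_coset (y : 'cV[int]_m) : set 'cV[int]_m :=
  [set y + A *m x | x in [set: 'cV[int]_n]].

Lemma image_coset_eq (y z : 'cV[int]_m) :
  image_coset y = image_coset z <-> exists x, z - y = A *m x.
Proof.
split=> [yz|[x zy]].
  have : image_coset z z by exists 0; rewrite ?mulmx0 ?addr0.
  by rewrite -yz => -[x _ <-]; exists x; rewrite addrC addKr.
have -> : z = y + A *m x by rewrite -zy addrC subrK.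
apply/seteqP; split=> _ [t _ <-].
  by exists (t - x) => //; rewrite mulmxBr [A *m t - _]addrC addrA addrK.
by exists (x + t) => //; rewrite mulmxDr addrA.
Qed.

(* If some delta i is 0, the index is infinite and image_index is 0 as well. *)
Lemma image_index_prod (L : 'M[int]_m) (delta : 'I_m -> int) :
  L \in unitmx ->
  (forall u : 'cV_m, (exists x, u = A *m x) <-> forall i, (delta i %| (L *m u) i 0%R)%Z) ->
  image_index A = (\prod_i `|delta i|)%N.
Proof.
move=> uL hL.
have cosetP (y z : 'cV[int]_m) : image_coset (invmx L *m y) = image_coset (invmx L *m z) <->
    forall i, (delta i %| z i 0%R - y i 0%R)%Z.
  rewrite image_coset_eq hL; rewrite -mulmxBr mulKVmx //.
  by split=> h i; have := h i; rewrite !mxE.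
have [/existsP[i /eqP di]|/existsPn nz] := boolP [exists i, delta i == 0].
  rewrite (bigD1 i) //= di mul0n /image_index.
  (* The multiples of the [i]-th coordinate vector lie in distinct cosets, because congruence modulo
     0 is equality. *)
  pose f (k : nat) := image_coset (invmx L *m (k%:Z *: delta_mx i 0)).
  have fsub : range f `<=` image_cosets A by move=> _ [k _ <-]; eexists.
  have finj : {in [set: nat] &, injective f}.
    move=> k l _ _ /cosetP/(_ i); rewrite di dvd0z !mxE !eqxx !mulr1 subr_eq0.
    by move=> /eqP[].
  have inf : ~ finite_set (image_cosets A).
    move=> /(sub_finite_set fsub); rewrite (eq_finite_set (inj_card_eq finj)).
    exact: infinite_nat.
  by rewrite /fset_set; case: pselect => //= _; rewrite cardfs0.
(* After applying [L], a coset is determined by its residues modulo the [delta i]; [T] is the set of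
   tuples of least nonnegative residues. *)
pose T := {dffun forall i : 'I_m, 'I_(`|delta i|)}.
pose r (t : T) : 'cV[int]_m := \col_i (t i : nat)%:Z.
have tcard : #|T| = (\prod_i `|delta i|)%N.
  rewrite card_dep_ffun foldrE big_map big_enum /=.
  by apply: eq_bigr => i _; rewrite card_ord.
rewrite /image_index; have -> : image_cosets A = range (fun t => image_coset (invmx L *m r t)).
  apply/seteqP; split=> _ [y _ <-]; last by eexists.
  have lt_mod i : (`|((L *m y) i 0%R %% delta i)%Z| < `|delta i|)%N.
    by rewrite -ltz_nat gez0_abs ?modz_ge0 ?ltz_mod ?nz.
  exists [ffun i => Ordinal (lt_mod i)] => //.
  rewrite -[in RHS](mulKmx uL y); apply/cosetP => i.
  rewrite [X in _ - X]mxE ffunE /= gez0_abs ?modz_ge0 ?nz //.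
  by rewrite {1}(divz_eq ((L *m y) i 0) (delta i)) addrK dvdz_mull.
apply: card_fset_set; rewrite -tcard; apply: card_eq_trans (inj_card_eq _) _.
  move=> t s _ _ /cosetP ts; apply/ffunP => i; apply/val_inj.
  have := ts i; rewrite !mxE -eqz_mod_dvd.
  rewrite -!(modz_abs _ (delta i)) !modz_small ?ltz_nat ?ltn_ord //.
  by move=> /eqP[/esym].
have -> : `I_#|T| = range (fun t : T => enum_rank t : nat).
  apply/seteqP; split=> [k kT|_ [t _ <-]]; last exact: ltn_ord.
  by exists (enum_val (Ordinal kT)) => //; rewrite enum_valK.
by rewrite card_eq_sym; apply: inj_card_eq => t s _ _ /val_inj/enum_rank_inj.
Qed.

(** With [D] the diagonal matrix of the [delta i], the index is the absolute value of its
    determinant. The columns of [L *m A] are divisible by [D], so every minor is a multiple of the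
    index. Conversely the columns of [D] lie in the image of [L *m A], so [\det D] is, up to sign, a
    combination of minors. *)
Lemma dvdn_image_index (g : nat) :
  (g %| image_index A)%N <->
  forall f : {ffun 'I_m -> 'I_n}, (g%:Z %| \det (colsub f A))%Z.
Proof.
have [L [delta [uL hL]]] := image_divisibility A.
have LE (M : 'M[int]_m) : (g%:Z %| \det (L *m M))%Z = (g%:Z %| \det M)%Z.
  rewrite det_mulmx !dvdzE abszM.
  by move: uL; rewrite unitmxE => /orP[] /eqP ->; rewrite mul1n.
pose D : 'M[int]_m := diag_mx (\row_i delta i).
have Dg : (g %| image_index A)%N = (g%:Z %| \det D)%Z.
  rewrite (image_index_prod uL hL) det_diag dvdzE /=.
  by under [in RHS]eq_bigr do rewrite mxE; rewrite -(big_morph _ abszM (erefl : `|1%Z|%N = 1%N)).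
split=> [|hg].
  rewrite Dg => gD f.
  have dvd (i j : 'I_m) : (delta i %| (L *m colsub f A) i j)%Z.
    have -> : (L *m colsub f A) i j = (L *m col (f j) A) i 0.
      by rewrite !mxE; apply: eq_bigr => k _; rewrite !mxE.
    by have /hL : exists x, col (f j) A = A *m x by exists (delta_mx (f j) 0); rewrite colE.
  rewrite -LE.
  have -> : L *m colsub f A =
      D *m \matrix_(i, j) ((L *m colsub f A) i j %/ delta i)%Z.
    apply/matrixP => i j; rewrite mul_diag_mx.
    by rewrite [RHS]mxE [X in X * _]mxE [X in _ * X]mxE mulrC divzK.
  by rewrite det_mulmx dvdz_mulr.
have colD i : exists x, invmx L *m (delta i *: delta_mx i 0 : 'cV_m) = A *m x.
  by apply/hL => k; rewrite mulKVmx // !mxE; case: eqP => [->|]; rewrite ?mulr1 ?mulr0.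
have [x hx] := choice colD.
have -> : (g %| image_index A)%N = (g%:Z %| \det (A *m \matrix_(i, j) x j i 0%R))%Z.
  rewrite Dg -[RHS]LE; congr (_ %| \det _)%Z; apply/matrixP => i j.
  transitivity ((L *m (A *m x j)) i 0); last first.
    rewrite mulmxA [LHS]mxE mulmxA [RHS]mxE; apply: eq_bigr => k _.
    by rewrite [in RHS]mxE.
  by rewrite -hx mulKVmx // !mxE eqxx andbT mulr_natr; case: eqP => [->|].
exact: dvdz_det_mulmx.
Qed.

End Cosets.

Lemma left_kernel_basis (m n : nat) (M : 'M[int]_(m, n)) :
  exists (k : nat) (K : 'M[int]_(k, m)), K *m M = 0 /\
    forall x : 'rV_m, x *m M = 0 -> exists! c : 'rV_k, x = c *m K.
Proof.
have [L uL [Q uQ [d _ ->]]] := int_Smith_normal_form M.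
set D := \matrix_(_, _) _.
have DE i j : D i j = d`_i *+ (i == j :> nat) by rewrite mxE.
(* The indices of the zero rows of the Smith form; the rows of [invmx L] at these indices form the
   basis. *)
pose S := [set i : 'I_m | (i < n)%N ==> (d`_i == 0)].
have ker0 (x : 'rV_m) : x *m (L *m D *m Q) = 0 <-> forall i, i \notin S -> (x *m L) 0 i = 0.
  rewrite !mulmxA; set y := x *m L; split=> [yDQ i|yS].
    rewrite inE negb_imply => /andP[lin di].
    have yD : y *m D = 0 by rewrite -(mulmxK uQ (y *m D)) yDQ mul0mx.
    have := congr1 (fun w : 'rV_n => w 0 (Ordinal lin)) yD.
    rewrite mxE [RHS]mxE (bigD1 i) //= big1 ?addr0 => [|k ki]; rewrite DE /=.
      by rewrite eqxx mulr1n => /eqP; rewrite mulf_eq0 (negPf di) orbF => /eqP.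
    by rewrite val_eqE (negPf ki) mulr0n mulr0.
  suff -> : y *m D = 0 by rewrite mul0mx.
  apply/rowP => j; rewrite mxE [RHS]mxE big1 // => i _; rewrite DE.
  have [ij|] := eqVneq (i : nat) j; last by rewrite mulr0n mulr0.
  have [|/yS -> ] := boolP (i \in S); last by rewrite mul0r.
  by rewrite inE ij ltn_ord => /eqP ->; rewrite mul0rn mulr0.
have Kcol (c : 'rV[int]_#|S|) : c *m rowsub enum_val (invmx L) *m L = \row_i
    \sum_k c 0 k * (enum_val k == i)%:R.
  rewrite -mulmxA; have -> : rowsub enum_val (invmx L) *m L = rowsub (@enum_val _ S) 1%:M.
    by rewrite mul_rowsub_mx mulVmx.
  by apply/rowP => i; rewrite !mxE; apply: eq_bigr => k _; rewrite !mxE.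
exists #|S|, (rowsub enum_val (invmx L)); split.
  apply/row_matrixP => k; rewrite row_mul row0; apply/ker0 => i iS.
  rewrite rowE Kcol mxE big1 // => l _.
  by case: eqP => [li|]; rewrite ?mulr0 //; case/negP: iS; rewrite -li enum_valP.
move=> x /ker0 xS.
have sumE (c : 'rV[int]_#|S|) k : \sum_l c 0 l * (enum_val l == enum_val k)%:R = c 0 k.
  rewrite (bigD1 k) //= eqxx mulr1 big1 ?addr0 // => l lk.
  by rewrite (inj_eq enum_val_inj) (negPf lk) mulr0.
exists (\row_k (x *m L) 0 (enum_val k)); split.
  rewrite -[LHS](mulmxK uL) -[RHS](mulmxK uL); congr (_ *m _).
  rewrite Kcol; apply/rowP => i; rewrite [RHS]mxE.
  have [iS|iS] := boolP (i \in S).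
    rewrite -(enum_rankK_in iS iS) sumE.
    by rewrite [RHS]mxE.
  rewrite xS // big1 // => l _; case: eqP => [li|]; rewrite ?mulr0 //.
  by case/negP: iS; rewrite -li enum_valP.
move=> c ->; rewrite Kcol; apply/rowP => k.
by rewrite !mxE sumE.
Qed.

(** * Cycles and bases of the first homology *)

Section Chains.
Variable G : graph.
Implicit Types (c : chain G) (d e : dart G) (v : vert G) (T : {set dart G}).

Definition antisymmetric_chain c := forall d, c (flip d) = - c d.
Definition boundary c v : int := \sum_(d in darts_at v) c d.

Lemma chain_lincombE (I : finType) (z : I -> chain G) (a : I -> int) d :
  (\sum_i z i *~ a i) d = \sum_i a i * z i d.
Proof.
rewrite sum_ffunE.
by apply: eq_bigr => i _; rewrite ffunMzE mulrzz mulrC.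
Qed.

Lemma boundaryE c v : boundary c v = \sum_d (src d == v)%:R * c d.
Proof.
rewrite /boundary big_mkcond; apply: eq_bigr => d _; rewrite inE.
by case: eqP; rewrite ?mul1r ?mul0r.
Qed.

Lemma chain_lincomb_cycle (I : finType) (z : I -> chain G) (a : I -> int) :
  (forall i, is_cycle (z i)) -> is_cycle (\sum_i z i *~ a i).
Proof.
move=> zC; split=> [d|v].
  rewrite !chain_lincombE -sumrN; apply: eq_bigr => i _.
  by rewrite (proj1 (zC i)) mulrN.
under eq_bigr do rewrite chain_lincombE.
rewrite exchange_big big1 // => i _; rewrite -mulr_sumr.
by rewrite (proj2 (zC i)) mulr0.
Qed.

Lemma cycleB c c' : is_cycle c -> is_cycle c' -> is_cycle (c - c').
Proof.
move=> [cA cB] [c'A c'B]; split=> [d|v]; first by rewrite !ffunE cA c'A opprD.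
by under eq_bigr do rewrite !ffunE; rewrite big_split sumrN /= cB c'B subr0.
Qed.

(** Cycles form an integral left kernel: the block [P] tests antisymmetry under [flip], and [Q]
    tests that the boundary vanishes. Existence also rules out the default values in [b1] and
    [some_H1_basis]. *)
Lemma H1_basis_exists : exists n (z : {ffun 'I_n -> chain G}), H1_basis z.
Proof.
pose row_of (c : chain G) := \row_(i < #|dart G|) c (enum_val i).
pose chain_of (x : 'rV[int]_#|dart G|) : chain G := [ffun d => x 0 (enum_rank d)].
have row_ofK c : chain_of (row_of c) = c.
  by apply/ffunP => d; rewrite ffunE mxE enum_rankK.
have chain_ofK x : row_of (chain_of x) = x.
  by apply/rowP => i; rewrite mxE ffunE enum_valK.
pose P := \matrix_(i < #|dart G|, j < #|dart G|)
  ((enum_val i == enum_val j)%:R + (enum_val i == flip (enum_val j))%:R : int).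
pose Q := \matrix_(i < #|dart G|, j < #|vert G|)
  ((src (enum_val i) == enum_val j)%:R : int).
have PE c d : (row_of c *m P) 0 (enum_rank d) = c d + c (flip d).
  rewrite mxE (reindex enum_rank) /=; last exact/onW_bij/enum_rank_bij.
  under eq_bigr do rewrite !mxE !enum_rankK mulrDr.
  rewrite big_split /=; congr (_ + _).
    rewrite (bigD1 d) //= eqxx mulr1 big1 ?addr0 // => e /negPf ->.
    by rewrite mulr0.
  rewrite (bigD1 (flip d)) //= eqxx mulr1 big1 ?addr0 // => e /negPf ->.
  by rewrite mulr0.
have QE c v : (row_of c *m Q) 0 (enum_rank v) = boundary c v.
  rewrite mxE (reindex enum_rank) /=; last exact/onW_bij/enum_rank_bij.
  by rewrite boundaryE; apply: eq_bigr => d _; rewrite !mxE !enum_rankK mulrC.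
have cycleP c : is_cycle c <-> row_of c *m row_mx P Q = 0.
  rewrite mul_mx_row -row_mx0; split=> [[cA cB]|/eq_row_mx[cP cQ]].
    congr row_mx; apply/rowP => i; rewrite [RHS]mxE -(enum_valK i).
      by rewrite PE cA subrr.
    by rewrite QE; apply: cB.
  split=> [d|v]; last by rewrite -[LHS]QE cQ mxE.
  by apply/eqP; rewrite -addr_eq0 addrC -PE cP mxE.
have [k [K [KM hK]]] := left_kernel_basis (row_mx P Q).
have combE (a : {ffun 'I_k -> int}) (c : chain G) :
    c = \sum_i [ffun i => chain_of (row i K)] i *~ a i <->
    row_of c = (\row_i a i) *m K.
  split=> [->|cK].
    apply/rowP => j; rewrite !mxE chain_lincombE; apply: eq_bigr => i _.
    by rewrite !ffunE !mxE enum_valK.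
  apply/ffunP => d; rewrite -(row_ofK c) cK chain_lincombE !ffunE !mxE.
  by apply: eq_bigr => i _; rewrite !ffunE !mxE.
exists k, [ffun i => chain_of (row i K)]; split=> [i|c /cycleP /hK[a [ca ua]]].
  by rewrite ffunE cycleP chain_ofK -row_mul KM row0.
exists [ffun i => a 0 i]; split=> [|b /combE cb].
  by apply/combE; rewrite ca; congr (_ *m _); apply/rowP => i; rewrite mxE ffunE.
by apply/ffunP => i; rewrite ffunE (ua _ cb) mxE.
Qed.

Lemma some_H1_basisP : H1_basis (some_H1_basis G).
Proof.
have b1P : exists z : {ffun 'I_(b1 G) -> chain G}, H1_basis z.
  exact: (xgetPex 0%N H1_basis_exists).
exact: (xgetPex _ b1P).
Qed.

Lemma b1_eq0_cycle c : b1 G = 0%N -> is_cycle c -> c = 0.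
Proof.
move=> b0 /(proj2 some_H1_basisP)[a [-> _]].
by rewrite big1 // => -[i ib] _; exfalso; rewrite b0 in ib.
Qed.

Definition unit_chain d : chain G := [ffun e => (e == d)%:R - (e == flip d)%:R].

Lemma unit_chain_flip d : antisymmetric_chain (unit_chain d).
Proof.
move=> e; rewrite !ffunE opprB (inj_eq (inv_inj (@flipK G))).
by rewrite -(inj_eq (inv_inj (@flipK G))) flipK.
Qed.

Lemma boundary_unit_chain d v :
  boundary (unit_chain d) v = (src d == v)%:R - (tgt d == v)%:R.
Proof.
rewrite boundaryE; under eq_bigr do rewrite ffunE mulrBr; rewrite sumrB /=.
congr (_ - _).
  by rewrite (bigD1 d) //= eqxx mulr1 big1 ?addr0 // => e /negPf ->; rewrite mulr0.
rewrite (bigD1 (flip d)) //= eqxx mulr1 big1 ?addr0 // => e /negPf ->.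
by rewrite mulr0.
Qed.

Lemma boundaryD c c' v : boundary (c + c') v = boundary c v + boundary c' v.
Proof. by rewrite /boundary -big_split; apply: eq_bigr => d _; rewrite ffunE. Qed.

(** The unit chains along a path in [T] add up, and their boundaries telescope. *)
Lemma path_chain T x y : edge_set T -> connect (adjacent_in T) x y ->
  exists c, [/\ antisymmetric_chain c, forall d, d \notin T -> c d = 0
    & forall v, boundary c v = (x == v)%:R - (y == v)%:R].
Proof.
move=> /forall_inP TE /connectP[p + ->]; elim: p x => [|w p IHp] x /=.
  move=> _; exists 0; split=> [d|d _|v]; rewrite ?ffunE ?oppr0 // subrr.
  by rewrite /boundary big1 // => d _; rewrite ffunE.
case/andP => /exists_inP[d dT /andP[/eqP <- /eqP <-]] /IHp[c [cA cT cB]].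
exists (unit_chain d + c); split=> [e|e eT|v].
- by rewrite [LHS]ffunE [X in - X]ffunE cA unit_chain_flip opprD.
- rewrite ffunE cT // addr0 ffunE.
  have neq e' : e' \in T -> (e == e') = false.
    by move=> Te'; apply: contraNF eT => /eqP->.
  by rewrite !neq ?subrr ?TE.
- by rewrite boundaryD boundary_unit_chain cB addrA subrK.
Qed.

End Chains.

(** * Spanning trees and minors of the cycle matrix *)

Lemma connect_crossing (T : finType) (e : rel T) (C : {set T}) x y :
  connect e x y -> x \in C -> y \notin C -> exists u v, [/\ e u v, u \in C & v \notin C].
Proof.
move=> /connectP[p + ->]; elim: p x => [|w p IHp] x /=; first by move=> _ ->.
move=> /andP[exw ewp] xC lC; have [wC|wC] := boolP (w \in C); first exact: IHp ewp wC lC.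
by exists x, w.
Qed.

Section TreeMinors.
Variables (G : graph) (o : pred (dart G)).
Hypothesis o_flip : forall d, o (flip d) = ~~ o d.

(** The net flow of a cycle through a cut is 0. Summed over all darts this follows from the
    vanishing boundary; each summand is invariant under [flip], so the sum over one dart per edge is
    half of that. *)
Lemma sum_cut_cycle (C : {set vert G}) (c : chain G) : is_cycle c ->
  \sum_(d | o d) c d * ((src d \in C)%:R - (tgt d \in C)%:R) = 0.
Proof.
move=> [cA cB]; pose F d : int := c d * ((src d \in C)%:R - (tgt d \in C)%:R).
have flipB : bijective (@flip G) by exists (@flip G); apply: flipK.
have srcC : \sum_d c d * (src d \in C)%:R = 0.
  transitivity (\sum_(v in C) boundary c v); last by apply: big1 => v _; apply: cB.
  under [RHS]eq_bigr do rewrite boundaryE.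
  rewrite exchange_big; apply: eq_bigr => d _; rewrite -mulr_suml mulrC.
  congr (_ * _); have [dC|dC] := boolP (src d \in C).
    by rewrite (bigD1 (src d)) //= eqxx big1 ?addr0 // => v /andP[_ /negPf]; rewrite eq_sym => ->.
  by rewrite big1 // => v vC; case: eqP => // dv; rewrite dv vC in dC.
have sumF : \sum_d F d = 0.
  rewrite /F; under eq_bigr do rewrite mulrBr; rewrite sumrB srcC sub0r.
  rewrite (reindex (@flip G)) /=; last exact: onW_bij.
  apply/eqP; rewrite oppr_eq0 -oppr_eq0 -sumrN -[X in _ == X]srcC; apply/eqP.
  by apply: eq_bigr => d _; rewrite cA mulNr opprK /tgt flipK.
have Fflip d : F (flip d) = F d by rewrite /F cA /tgt flipK mulNr -mulrN opprB.
have : (\sum_(d | o d) F d) *+ 2 = 0.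
  rewrite -[RHS]sumF [RHS](bigID o) /= mulr2n; congr (_ + _).
  rewrite [RHS](reindex (@flip G)) /=; last exact: onW_bij.
  by apply: eq_big => d; rewrite ?o_flip ?negbK ?Fflip.
by move/eqP; rewrite mulrn_eq0 /= => /eqP.
Qed.

Variables (m : nat) (z : {ffun 'I_m -> chain G}).
Hypothesis zB : H1_basis z.

Lemma H1_basis_free (a : 'I_m -> int) : \sum_i z i *~ a i = 0 -> forall i, a i = 0.
Proof.
move=> az i; have /(proj2 zB)[b [_ bU]] : is_cycle (0 : chain G).
  by split=> [d|v]; rewrite ?big1 // => *; rewrite !ffunE ?oppr0.
have E a' : \sum_i z i *~ a' i = 0 -> b = [ffun i => a' i].
  by move=> a'z; apply: bU; rewrite -[LHS]a'z; apply: eq_bigr => j _; rewrite ffunE.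
have := E _ az; rewrite (E (fun=> 0)) => [/ffunP/(_ i)|]; first by rewrite !ffunE.
by rewrite big1 // => j _; rewrite mulr0z.
Qed.

Definition cycle_mx (k : nat) (g : 'I_k -> dart G) : 'M[int]_(m, k) :=
  \matrix_(i, j) z i (g j).

Definition off_darts (k : nat) (g : 'I_k -> dart G) : {set dart G} :=
  [set d | [forall j, (g j != d) && (g j != flip d)]].

Lemma row_cycle_mx (k : nat) (g : 'I_k -> dart G) (a : 'I_m -> int) j :
  ((\row_i a i) *m cycle_mx g) 0 j = (\sum_i z i *~ a i) (g j).
Proof. by rewrite mxE chain_lincombE; apply: eq_bigr => i _; rewrite !mxE. Qed.

Lemma det_cycle_mx_inj (g : 'I_m -> dart G) : \det (cycle_mx g) != 0 -> injective g.
Proof.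
move=> det_neq0 j l gjl; apply/eqP; apply: contraNT det_neq0 => jl.
by rewrite -det_tr (determinant_alternate jl) // => i; rewrite !mxE gjl.
Qed.

Lemma det_cycle_mx_tree (g : 'I_m -> dart G) :
  connected_by [set: dart G] -> (forall j, o (g j)) ->
  \det (cycle_mx g) != 0 -> spanning_tree (off_darts g).
Proof.
move=> /andP[V_gt0 /forallP Gconn] og det_neq0.
have g_inj := det_cycle_mx_inj det_neq0.
set T := off_darts g.
have TE d : d \in T -> flip d \in T.
  rewrite !inE => /forallP gd; apply/forallP => j.
  by rewrite flipK andbC gd.
have TP d : d \notin T -> exists j, g j = d \/ g j = flip d.
  rewrite inE negb_forall => /existsP[j]; rewrite negb_and !negbK.
  by move=> /orP[/eqP <-|/eqP gj]; exists j; [left|right].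
split; first exact/forall_inP.
  rewrite /connected_by V_gt0 /=; apply/forallP => x; apply/forallP => y.
  (* The component of x yields a cut all of whose edges are among the g j. *)
  apply: contraT => xy; pose C := [set v | connect (adjacent_in T) x v].
  have Tsrc d : d \in T -> (src d \in C) = (tgt d \in C).
    move=> dT; rewrite !inE; apply/idP/idP => xd; apply: connect_trans xd _; apply: connect1.
      by apply/exists_inP; exists d; rewrite ?eqxx.
    by apply/exists_inP; exists (flip d); rewrite ?TE // /tgt flipK !eqxx.
  have [u [v [/exists_inP[d _ /andP[/eqP du /eqP dv]] uC vC]]] : exists u v,
      [/\ adjacent_in [set: dart G] u v, u \in C & v \notin C].
    apply: connect_crossing (forallP (Gconn x) y) _ _; rewrite inE //.
  have [j gj] : exists j, g j = d \/ g j = flip d.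
    by apply: TP; apply: contraNN vC => /Tsrc; rewrite du dv uC => <-.
  (* The signed incidence of the edges [g l] with the cut around [C]: a relation between the columns
     by [sum_cut_cycle], nonzero at [j] because [g j] crosses the cut. *)
  pose w : 'rV[int]_m := \row_l ((src (g l) \in C)%:R - (tgt (g l) \in C)%:R).
  case/negP: det_neq0; rewrite -det_tr; apply/det0P; exists w.
    apply/eqP => /rowP/(_ j); rewrite !mxE.
    by case: gj => ->; rewrite /tgt ?flipK -/(tgt d) du dv uC (negPf vC).
  apply/rowP => i; rewrite [RHS]mxE -[RHS](sum_cut_cycle C (proj1 zB i)) mxE.
  rewrite [RHS](bigID (mem [set g l | l : 'I_m])) /= [X in _ + X]big1 ?addr0.
    rewrite [RHS](eq_bigl (mem [set g l | l : 'I_m])); last first.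
      by move=> d'; apply: andb_idl => /imsetP[l _ ->].
    rewrite big_imset /=; last by move=> ? ? _ _; apply: g_inj.
    by apply: eq_bigr => l _; rewrite !mxE mulrC.
  move=> d' /andP[od' /negP d'g]; rewrite Tsrc ?subrr ?mulr0 //.
  apply: contraT => /TP[l [gl|gl]]; first by case: d'g; rewrite -gl imset_f.
  by have := og l; rewrite gl o_flip od'.
(* A cycle supported on [T] vanishes on every [g j], so its coordinates in [z] are a relation
   between the rows of an invertible matrix over the rationals. *)
move=> c /[dup] cC /(proj2 zB)[a [ca _]] cT.
have : (\row_i a i) *m cycle_mx g = 0.
  apply/rowP => j; rewrite row_cycle_mx -ca mxE cT // inE negb_forall.
  by apply/existsP; exists j; rewrite eqxx.
move=> ag; have [a0|a_neq0] := eqVneq (\row_i a i) 0; last first.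
  by case/negP: det_neq0; apply/det0P; exists (\row_i a i).
rewrite ca; apply/ffunP => d; rewrite chain_lincombE ffunE big1 // => i _.
by have /rowP/(_ i) := a0; rewrite !mxE => ->; rewrite mul0r.
Qed.

(* The rows of the inverse are the coordinates of the fundamental cycles of T. *)
Lemma tree_cycle_mx (T : {set dart G}) (k : nat) (g : 'I_k -> dart G) :
  spanning_tree T -> injective g ->
  (forall j, o (g j) && (g j \notin T)) ->
  (forall d, o d -> d \notin T -> exists j, g j = d) ->
  exists2 a : 'M[int]_(k, m), a *m cycle_mx g = 1%:M & cycle_mx g *m a = 1%:M.
Proof.
move=> [/forall_inP TE /andP[_ /forallP Tconn] Tcyc] g_inj gT g_onto.
(* Close up [g j] by a path in [T] from its target to its source; the path avoids all [g l], which
   gives the Kronecker values. *)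
have /choice[c hc] : forall j, exists c : chain G,
    is_cycle c /\ forall l, c (g l) = (j == l)%:R.
  move=> j; have [p [pA pT pB]] :=
    path_chain (introT forall_inP TE) (forallP (Tconn (tgt (g j))) (src (g j))).
  exists (unit_chain (g j) + p); split.
    split=> [d|v]; first by rewrite [LHS]ffunE [X in - X]ffunE pA unit_chain_flip opprD.
    by rewrite -/(boundary _ v) boundaryD boundary_unit_chain pB addrA subrK subrr.
  move=> l; have /andP[ogl glT] := gT l; have /andP[ogj _] := gT j.
  rewrite ffunE pT // addr0 ffunE (inj_eq g_inj) [l == j]eq_sym.
  by case: eqP => [|_]; case: eqP => [gl|_] //; move: ogl; rewrite gl o_flip ogj.
have /choice[a ha] : forall j, exists a : {ffun 'I_m -> int}, c j = \sum_i z i *~ a i.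
  by move=> j; have [a [ca _]] := proj2 zB _ (proj1 (hc j)); exists a.
exists (\matrix_(j, i) a j i).
  apply/matrixP => j l; rewrite !mxE -(proj2 (hc j)) ha chain_lincombE.
  by apply: eq_bigr => i _; rewrite !mxE.
(* The difference of the two sides vanishes off [T], so it is a cycle in the tree and hence 0. *)
have zE i : z i = \sum_j c j *~ z i (g j).
  apply/eqP; rewrite -subr_eq0; apply/eqP; apply: Tcyc.
    by apply: cycleB; [apply: (proj1 zB)|apply: chain_lincomb_cycle => j; apply: (proj1 (hc j))].
  have vanish d : o d -> d \notin T -> (z i - \sum_j c j *~ z i (g j)) d = 0.
    move=> od /(g_onto _ od)[l <-]; rewrite !ffunE chain_lincombE.
    rewrite (bigD1 l) //= (proj2 (hc l)) eqxx mulr1 big1 ?addr0 ?subrr // => j.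
    by rewrite (proj2 (hc j)) => /negPf->; rewrite mulr0.
  have rC : is_cycle (z i - \sum_j c j *~ z i (g j)).
    by apply: cycleB; [apply: (proj1 zB)|apply: chain_lincomb_cycle => j; apply: (proj1 (hc j))].
  move=> d dT; have [od|od] := boolP (o d); first exact: vanish.
  rewrite -[d]flipK (proj1 rC) vanish ?oppr0 ?o_flip //.
  by apply: contraNN dT => /TE; rewrite flipK.
(* The rows of this product are the coordinates of [z i] obtained by expanding it in the [c j] and
   these back in the basis; freeness forces them to be those of the identity. *)
apply/matrixP => i l; rewrite !mxE.
apply/eqP; rewrite -subr_eq0; apply/eqP.
apply: (H1_basis_free (a := fun l =>
  \sum_j cycle_mx g i j * (\matrix_(j, i) a j i) j l - (i == l)%:R)).
apply/ffunP => d; rewrite chain_lincombE [RHS]ffunE.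
under eq_bigr do rewrite mulrBl; rewrite sumrB /=.
apply/eqP; rewrite subr_eq0; apply/eqP.
transitivity (z i d); last first.
  rewrite (bigD1 i) //= eqxx mul1r big1 ?addr0 // => j.
  by rewrite eq_sym => /negPf ->; rewrite mul0r.
rewrite [in RHS]zE chain_lincombE.
under eq_bigr do rewrite mulr_suml; rewrite exchange_big /=.
apply: eq_bigr => j _; rewrite ha chain_lincombE mulr_sumr.
by apply: eq_bigr => l' _; rewrite !mxE mulrA.
Qed.

(** A two-sided inverse over the integers forces the matrix to be square, which shows that the
    number of edges off a spanning tree is the rank of the first homology. *)
Lemma tree_cycle_mx_det (T : {set dart G}) (k : nat) (g : 'I_k -> dart G) :
  spanning_tree T -> injective g ->
  (forall j, o (g j) && (g j \notin T)) ->
  (forall d, o d -> d \notin T -> exists j, g j = d) ->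
  exists e : m = k, \det (cycle_mx (g \o cast_ord e)) \in GRing.unit.
Proof.
move=> Tt gi gT gs; have [a aZ Za] := tree_cycle_mx Tt gi gT gs.
have e : m = k.
  by apply/eqP; rewrite eqn_leq (mulmx1_min aZ) (mulmx1_min Za).
exists e; subst k; have := mulmx1_unit Za => -[uZ _].
rewrite (_ : cycle_mx _ = cycle_mx g) -?unitmxE //.
by apply/matrixP => i j; rewrite !mxE /= cast_ord_id.
Qed.

End TreeMinors.

(** A connected edge set must leave the vertex [src d], and [d] is the only way out. It is not a
    loop, since then [flip d] would be a second dart there. *)
Lemma pendant_tree (G : graph) (d : dart G) (T : {set dart G}) :
  darts_at (src d) = [set d] -> connected_by T -> d \in T.
Proof.
move=> sd /andP[_ /forallP/(_ (src d))/forallP/(_ (tgt d))] conn.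
have [|u [v [/exists_inP[e eT /andP[/eqP eu _]] + _]]] :=
    connect_crossing (C := [set src d]) conn (set11 _).
  rewrite inE; apply/eqP => td.
  have : flip d \in darts_at (src d) by rewrite inE -td.
  by rewrite sd inE (negPf (flip_neq d)).
rewrite inE -eu => /eqP es; have : e \in darts_at (src d) by rewrite inE es.
by rewrite sd inE => /eqP <-.
Qed.

(** * Automorphisms of rational covers *)

(** The columns of the block of the first [n] rows also sum to 0, so this square block is singular;
    a left kernel vector of it is padded by zeros. *)
Lemma left_kernel_neq0 (m n : nat) (M : 'M[int]_(m, n)) : (0 < n <= m)%N ->
  M *m const_mx 1 = 0 :> 'cV_m -> exists2 x : 'rV_m, x != 0 & x *m M = 0.
Proof.
move=> /andP[n0 nm] M1; pose w := widen_ord nm.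
have /det0P[x x0 xM] : \det (rowsub w M) == 0.
  rewrite -det_tr; apply/det0P; exists (const_mx 1).
    by apply/eqP => /rowP/(_ (Ordinal n0)); rewrite !mxE.
  apply: trmx_inj; rewrite trmx_mul trmxK trmx_const trmx0 mul_rowsub_mx M1.
  by apply/colP => i; rewrite !mxE.
exists (x *m rowsub w 1%:M); last by rewrite -mulmxA mul_rowsub_mx mul1mx.
apply: contraNneq x0 => xw; apply/eqP/rowP => j.
have /rowP/(_ (w j)) := xw; rewrite !mxE (bigD1 j) //= !mxE eqxx mulr1.
rewrite big1 ?addr0 // => i ij; rewrite !mxE.
by rewrite -val_eqE /= val_eqE (negPf ij) mulr0.
Qed.

(* Otherwise a double count of darts gives at least as many edges as vertices; the columns of the
   incidence matrix sum to 0, so its rows are dependent, which yields a nonzero cycle. *)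
Lemma forest_valence1 (G : graph) (o : pred (dart G)) (N : {set dart G}) :
  (forall d, o (flip d) = ~~ o d) -> (forall c : chain G, is_cycle c -> c = 0) ->
  edge_set N -> N != set0 -> exists v, #|darts_at v :&: N| = 1%N.
Proof.
move=> oN acyc /forall_inP NE /set0Pn[d0 d0N].
suff /existsP[v /eqP v1] : [exists v, #|darts_at v :&: N| == 1%N] by exists v.
apply: contraT => /existsPn val1.
pose E := [set d in N | o d]; pose V := [set v | darts_at v :&: N != set0].
have srcV d : d \in N -> src d \in V.
  by move=> dN; rewrite inE; apply/set0Pn; exists d; rewrite !inE eqxx.
have NEE : #|N| = (#|E| + #|E|)%N.
  rewrite -(cardsID [set d | o d]) (_ : N :&: _ = E); last first.
    by apply/setP => d; rewrite !inE.
  congr (_ + _)%N; rewrite -(card_imset _ (inv_inj (@flipK G))).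
  apply: eq_card => d; rewrite !inE; apply/imsetP/andP => [[e] | [dN od]].
    by rewrite !inE => /andP[od eN] ->; rewrite oN od NE.
  by exists (flip d); rewrite ?flipK // !inE oN od NE.
have NV : #|N| = (\sum_(v in V) #|darts_at v :&: N|)%N.
  rewrite -sum1_card (partition_big (@src G) (mem V)) //=.
  apply: eq_bigr => v _; rewrite -sum1_card; apply: eq_bigl => d.
  by rewrite !inE andbC.
have VE : (#|V| <= #|E|)%N.
  rewrite -leq_double -!addnn -NEE NV addnn -muln2 -sum_nat_const.
  apply: leq_sum => v; rewrite inE -card_gt0 => vN.
  by rewrite ltn_neqAle eq_sym val1.
have V0 : (0 < #|V|)%N by apply/card_gt0P; exists (src d0); apply: srcV.
pose M := \matrix_(i < #|E|, j < #|V|)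
  ((src (enum_val i) == enum_val j)%:R - (tgt (enum_val i) == enum_val j)%:R : int).
have sumV u : u \in V -> \sum_(j < #|V|) ((u == enum_val j)%:R : int) = 1.
  move=> uV; rewrite (bigD1 (enum_rank_in uV u)) //= enum_rankK_in // eqxx.
  rewrite big1 ?addr0 // => j ju; case: eqP => // uj.
  by case/eqP: ju; apply: enum_val_inj; rewrite enum_rankK_in.
have [|x x0 xM] := left_kernel_neq0 (M := M) (introT andP (conj V0 VE)).
  apply/colP => i; rewrite !mxE; under eq_bigr do rewrite !mxE mulr1.
  have iN : enum_val i \in N by have := enum_valP i; rewrite inE => /andP[].
  by rewrite sumrB !sumV ?subrr ?srcV ?NE.
pose c : chain G := \sum_i unit_chain (enum_val i) *~ x 0 i.
have cC : is_cycle c.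
  split=> [d|v].
    rewrite !chain_lincombE -sumrN; apply: eq_bigr => i _.
    by rewrite unit_chain_flip mulrN.
  under eq_bigr do rewrite chain_lincombE; rewrite exchange_big /=.
  under eq_bigr => i _ do rewrite -mulr_sumr -/(boundary _ v) boundary_unit_chain.
  have [vV|vV] := boolP (v \in V).
    have /rowP/(_ (enum_rank_in vV v)) := xM; rewrite !mxE => {2}<-.
    by apply: eq_bigr => i _; rewrite !mxE enum_rankK_in.
  rewrite big1 // => i _.
  have iN : enum_val i \in N by have := enum_valP i; rewrite inE => /andP[].
  have neq u : u \in V -> (u == v) = false by move=> uV; apply: contraNF vV => /eqP <-.
  by rewrite !neq ?srcV ?NE // subrr mulr0.
(* [E] holds one dart per edge, so at the [i]-th dart only the [i]-th unit chain is nonzero and [c]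
   takes the value [x 0 i]. *)
case/negP: x0; apply/eqP/rowP => i; rewrite mxE.
have /ffunP/(_ (enum_val i)) := acyc c cC; rewrite chain_lincombE ffunE (bigD1 i) //=.
have oE (j : 'I_#|E|) : o (enum_val j) by have := enum_valP j; rewrite inE => /andP[].
have nflip (j k : 'I_#|E|) : (enum_val j == flip (enum_val k)) = false.
  by apply/eqP => jk; have := oE j; rewrite jk oN oE.
rewrite ffunE eqxx nflip subr0 mulr1 big1 ?addr0 // => j ji.
by rewrite ffunE nflip (inj_eq enum_val_inj) eq_sym (negPf ji) subrr mulr0.
Qed.

Section Covers.
Variables (R : realType) (h : lcover R).
Local Notation a := (cover_type_of h).

Lemma outward_flip (d : dart a) : outward (flip d) = ~~ outward d.
Proof.
by rewrite /outward /= cslope_rev oppr_gt0 -leNgt lt_neqAle cslope_neq0.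
Qed.

(** Automorphisms preserve lengths; through this criterion they map ends to ends, so that
    injectivity of the marking applies to the image of an end. *)
Lemma is_endE (d : dart h) : is_end d = (len d == +oo%E).
Proof.
apply/idP/eqP => [/len_end//|dl]; apply: contraT => /len_bounded.
by rewrite dl ltxx andbF.
Qed.

Lemma cover_Aut_rational : (forall c : chain h, is_cycle c -> c = 0) ->
  cover_Aut h = [set (1%g, 1%g)].
Proof.
move=> acyc; apply/setP => f; rewrite !inE; apply/idP/eqP => [|->]; last first.
  by rewrite /=; do !(apply/andP; split); apply/forallP => x;
    rewrite ?perm1 ?eqxx ?implybT.
case/and5P => /forallP fsrc /forallP fflip /forallP flen _.
case/and5P => _ /forallP fmark _ /forallP fslope _.
have fixed d : f.2 d = d.
  apply/eqP; apply: contraT => fd.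
  pose N := [set d | f.2 d != d].
  have NE : edge_set N.
    apply/forall_inP => e; rewrite !inE -(eqP (fflip e)).
    by rewrite (inj_eq (inv_inj (@flipK _))).
  have /set0Pn N0 : exists e, e \in N by exists d; rewrite inE.
  have [v /eqP/cards1P[e ve]] := forest_valence1 outward_flip acyc NE N0.
  have : e \in darts_at v :&: N by rewrite ve set11.
  rewrite !inE => /andP[/eqP ev fe]; case/negP: (fe).
  (* At a leaf, the marking leaves only [e] and [flip e] as images, and the sign of the slope
     excludes [flip e]. At an inner vertex a second edge is fixed, hence so is [v]; then [f.2 e] is
     again a moved dart at [v], so it is [e]. *)
  have [lv|lv] := boolP (leaf v).
    have ee : is_end e by rewrite /is_end ev lv.
    have fee : is_end (f.2 e) by rewrite is_endE (eqP (flen e)) -is_endE.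
    have := implyP (fmark e) ee => /eqP me; have [->//|fle] := mark_inj ee fee (esym me).
    have := eqP (fslope e); rewrite fle cslope_rev => /eqP.
    by rewrite -subr_eq0 -opprD oppr_eq0 -mulr2n mulrn_eq0 /= (negPf (cslope_neq0 e)).
  have [e' e'v e'e] : exists2 e', e' \in darts_at v & e' != e.
    apply/exists_inP; apply: contraNT lv => /exists_inPn eall.
    apply/cards1P; exists e; apply/setP => e'; rewrite [RHS]inE.
    apply/idP/eqP => [/eall|->]; last by rewrite inE ev.
    by rewrite negbK => /eqP.
  have fe' : f.2 e' = e'.
    apply/eqP; apply: contraNT e'e => fe'; have : e' \in darts_at v :&: N.
      by rewrite inE e'v inE.
    by rewrite ve inE.
  have fv : f.1 v = v.
    by move: e'v; rewrite inE => /eqP <-; rewrite -(eqP (fsrc e')) fe'.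
  have : f.2 e \in darts_at v :&: N.
    by rewrite !inE (eqP (fsrc e)) ev fv eqxx (inj_eq perm_inj).
  by rewrite ve inE.
have fixed1 v : f.1 v = v.
  have [/existsP[d /eqP <-]|/existsPn nov] := boolP [exists d : dart h, src d == v].
    by rewrite -(eqP (fsrc d)) fixed.
  (* A vertex without darts has no path to any other vertex, so by connectedness it equals its
     image. *)
  have /andP[_ /forallP/(_ v)/forallP/(_ (f.1 v))/connectP[[|w p] /=]] :=
    ctcurve_connected h; first by [].
  by case/andP => /exists_inP[d _ /andP[dv _]]; have := nov d; rewrite dv.
by case: f {fsrc fflip flen fmark fslope} fixed fixed1 => f1 f2 /= f2E f1E;
  congr pair; apply/permP => x; rewrite perm1.
Qed.

(** Leaves are mapped to points at infinity, never to c, so the identification does not touch them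
    and they stay one-valent. *)
Lemma glue_leaf (d : dart h) : leaf (src d) ->
  darts_at (G := glued a) (src (g := glued a) d) = [set d].
Proof.
move=> ld; have dc : src d \notin over_c a.
  rewrite inE; move: (pos_leaf (src d)); rewrite ld.
  by move/esym/existsP => [i /eqP ->].
have /cards1P[e de] := ld.
have /[1!de] : d \in darts_at (src d) by rewrite inE.
rewrite inE => /eqP ed; rewrite -{}ed in de.
rewrite -de; apply/setP => e'; rewrite !inE -val_eqE /= /glue_class (negPf dc).
case: ifP => [e'c|_]; last by rewrite (inj_eq set1_inj).
apply/eqP/eqP => [cd|e'd]; first by case/negP: dc; rewrite cd set11.
by case/negP: dc; rewrite -e'd.
Qed.

Lemma glued_connected : connected_by (G := glued a) [set: dart (glued a)].
Proof.
have /andP[/card_gt0P[v0 _] /forallP conn] := ctcurve_connected h.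
have glue_onto (x : vert (glued a)) : exists v, x = Defs.glue v.
  by have /imsetP[v _ xv] := valP x; exists v; apply: val_inj.
apply/andP; split; first by apply/card_gt0P; exists (@Defs.glue a v0).
apply/forallP => x; apply/forallP => y; have [v ->] := glue_onto x.
have [w ->] := glue_onto y; have /connectP[p + ->] := forallP (conn v) w.
elim: p v => [|u p IHp] v //= /andP[/exists_inP[d _ /andP[/eqP <- /eqP <-]] dp].
apply: connect_trans (IHp _ dp); apply: connect1; apply/exists_inP; exists d => //.
by rewrite !eqxx.
Qed.

Lemma end_tree (d : dart h) (T : {set dart (glued a)}) :
  is_end d -> spanning_tree T -> d \in T.
Proof.
move=> + [/forall_inP TE Tconn _]; case/orP => ld; first exact: pendant_tree (glue_leaf ld) Tconn.
have := TE _ (pendant_tree (glue_leaf ld) Tconn).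
by rewrite /= flipK.
Qed.

End Covers.

(** * The index of a cover type *)

Section Index.
Variables (R : realType) (h : lcover R).
Local Notation a := (cover_type_of h).
Local Notation z := (some_H1_basis (glued a)).

Lemma bounded_edge_outward (j : 'I_#|bounded_edges a|) : outward (enum_val j).
Proof. by have := enum_valP j; rewrite inE => /andP[]. Qed.

Lemma det_minor (f : 'I_(b1 (glued a)) -> 'I_#|bounded_edges a|) :
  \det (colsub f (A_mx a)) =
  \det (cycle_mx z (fun j => enum_val (f j))) * (\prod_j wt (enum_val (f j)))%:R.
Proof.
transitivity (\det (cycle_mx z (fun j => enum_val (f j)) *m
    diag_mx (\row_j (wt (enum_val (f j)))%:Z))).
  by congr (\det _); apply/matrixP => i j; rewrite mul_mx_diag !mxE mulrC.
rewrite det_mulmx det_diag; congr (_ * _); rewrite natr_prod.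
by apply: eq_bigr => j _; rewrite mxE natz.
Qed.

(** Same right-hand side as in [dvdn_image_index], so the two numbers have the same divisors. A
    nonzero minor is a multiple of the weight product of some tree complement, and every such
    product is a minor up to sign. *)
Lemma dvdn_gcd_trees (g : nat) : (g %| gcd_trees a)%N <->
  forall f : {ffun 'I_(b1 (glued a)) -> 'I_#|bounded_edges a|},
    (g%:Z %| \det (colsub f (A_mx a)))%Z.
Proof.
have zB := some_H1_basisP (glued a).
split=> [gT f|gf].
  pose e j := enum_val (f j).
  have [det0|det_neq0] := eqVneq (\det (cycle_mx z e)) 0.
    by rewrite det_minor det0 mul0r dvdz0.
  have eo j : outward (e j) by apply: bounded_edge_outward.
  have e_inj := det_cycle_mx_inj det_neq0.
  have tree := @det_cycle_mx_tree (glued a) _ (@outward_flip _ h) _ _ zB _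
    (glued_connected h) eo det_neq0.
  rewrite det_minor natz dvdz_mull // dvdzE /=.
  have /dvdn_biggcdP/(_ _ (asboolT tree)) := gT.
  (* The outward darts off the tree are exactly the chosen [e j]: the reverse of an [e j] is not
     outward. *)
  rewrite (eq_bigl (mem [set e j | j in 'I_(b1 (glued a))])); last first.
    move=> d; rewrite !inE negb_forall.
    apply/andP/imsetP => [[/existsP[j] + od]|[j _ ->]].
      rewrite negb_and !negbK => /orP[/eqP <-|/eqP ej]; first by exists j.
      by have := eo j; rewrite ej outward_flip od.
    by split=> //; apply/existsP; exists j; rewrite eqxx.
  by rewrite big_imset //= => ? ? _ _; apply: e_inj.
apply/dvdn_biggcdP => T /asboolP tree.
pose S := [set d : dart a | (d \notin T) && outward d].
have SP (j : 'I_#|S|) : outward (enum_val j) && (enum_val j \notin T).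
  by have := enum_valP j; rewrite inE andbC.
have [d od dT|eb det_unit] :=
    @tree_cycle_mx_det (glued a) _ (@outward_flip _ h) _ _ zB T _ _ tree enum_val_inj SP.
  have dS : d \in S by rewrite inE dT.
  by exists (enum_rank_in dS d); rewrite enum_rankK_in.
(* Ends lie in the tree, so each edge off [T] is bounded and indexes a column of [A_mx]. *)
have /choice[f hf] : forall j : 'I_(b1 (glued a)), exists k : 'I_#|bounded_edges a|,
    enum_val k = enum_val (cast_ord eb j).
  move=> j; have /andP[oj jT] := SP (cast_ord eb j).
  have jB : enum_val (cast_ord eb j) \in bounded_edges a.
    by rewrite inE oj andbT; apply: contraNN jT => /end_tree; apply.
  by exists (enum_rank_in jB (enum_val (cast_ord eb j))); rewrite enum_rankK_in.
have := gf [ffun j => f j]; rewrite det_minor dvdzE abszM natz /=.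
rewrite (_ : cycle_mx _ _ = cycle_mx z (enum_val \o cast_ord eb)); last first.
  by apply/matrixP => i j; rewrite !mxE ffunE hf.
have -> : `|\det (cycle_mx z (enum_val \o cast_ord eb))|%N = 1%N.
  by move: det_unit => /orP[] /eqP ->.
rewrite mul1n => g_dvd.
rewrite (eq_bigl (mem S)) => [|d]; last by rewrite /= inE.
rewrite big_enum_val (reindex (cast_ord eb)) /=; last first.
  by apply: onW_bij; exists (cast_ord (esym eb)) => j; rewrite ?cast_ordK ?cast_ordKV.
rewrite (_ : \prod_j _ = (\prod_j wt (enum_val ([ffun j => f j] j)))%N) //.
by apply: eq_bigr => j _; rewrite ffunE hf.
Qed.

End Index.

Theorem proposition2p24 (R : realType) (h : lcover R)
    (hrational : genus h = 0%N)
    (htrivalent : trivalent (cover_type_of h)) :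
  omega h = gmo_weight R (cover_type_of h).
Proof.
(* Genus 0 makes the domain itself a tree; the glued graph may still have cycles. *)
have acyc (c : chain h) : is_cycle c -> c = 0.
  by apply: b1_eq0_cycle; move/eqP: hrational; rewrite addn_eq0 => /andP[/eqP].
have -> : gmo_weight R (cover_type_of h) =
    (\prod_(v in over_c (cover_type_of h)) H_vert R v) * (I_index (cover_type_of h))%:R.
  congr (_ * _%:R); apply/eqP; rewrite eqn_dvd.
  apply/andP; split; first by apply/dvdn_image_index/dvdn_gcd_trees.
  by apply/dvdn_gcd_trees/dvdn_image_index.
by rewrite /omega cover_Aut_rational // cards1 invr1 mul1r mulrC.
Qed.
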